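(* For all integers $m\ge 0$ and $k\ge 1$, $$S_2(m+k,k)=\binom{m+k}{m}\sum_{n=0}^{m}C_n^{(k)}S_2(m,n)=\binom{m+k}{m}\sum_{n=0}^{m}B_n^{(n-k+1)}(1)\,S_2(m,n).$$
   Context: $(x)_n = x(x-1)\cdots(x-n+1)$ denotes the falling factorial, with $(x)_0=1$. For integers $k\ge 1$, $n\ge 0$, the Cauchy numbers of the first kind of order $k$ are $$C_n^{(k)}=\int_0^1\cdots\int_0^1 (x_1+\cdots+x_k)_n\,dx_1\cdots dx_k.$$ $S_2(l,n)$ are the Stirling numbers of the second kind, defined by $(e^t-1)^n=n!\sum_{l=n}^\infty S_2(l,n)\frac{t^l}{l!}$. For an integer $\alpha$ (possibly zero or negative), the Bernoulli polynomials $B_n^{(\alpha)}(x)$ of order $\alpha$ are defined by the formal power series identity $\left(\frac{t}{e^t-1}\right)^{\alpha}e^{xt}=\sum_{n=0}^\infty B_n^{(\alpha)}(x)\frac{t^n}{n!}$. *)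

(* Defs.v *)
From HB Require Import structures.
From mathcomp Require Import all_boot all_order all_algebra.
From mathcomp Require Import all_classical all_reals all_analysis.
From mathcomp Require Import ring.

Set Implicit Arguments.
Unset Strict Implicit.
Unset Printing Implicit Defensive.

Import Order.TTheory GRing.Theory Num.Theory.

Local Open Scope classical_set_scope.
Local Open Scope ring_scope.

Record fps (F : Type) := FPS { coefs : nat -> F }.

Section FpsRing.
Variable F : fieldType.
Implicit Types (f g h : fps F).

HB.instance Definition _ := [isNew for @coefs F].
HB.instance Definition _ := [Choice of fps F by <:].

Lemma fpsP f g : coefs f =1 coefs g -> f = g.
Proof. by case: f g => [f] [g] /= /funext ->. Qed.

Definition fps_zero : fps F := FPS (fun=> 0).
Definition fps_opp f : fps F := FPS (fun n => - coefs f n).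
Definition fps_add f g : fps F := FPS (fun n => coefs f n + coefs g n).
Definition fps_one : fps F := FPS (fun n => (n == 0)%:R).
Definition fps_mul f g : fps F :=
  FPS (fun n => \sum_(i < n.+1) coefs f i * coefs g (n - i)).

Lemma fps_addA : associative fps_add.
Proof. by move=> f g h; apply: fpsP => n /=; rewrite addrA. Qed.

Lemma fps_addC : commutative fps_add.
Proof. by move=> f g; apply: fpsP => n /=; rewrite addrC. Qed.

Lemma fps_add0 : left_id fps_zero fps_add.
Proof. by move=> f; apply: fpsP => n /=; rewrite add0r. Qed.

Lemma fps_addN : left_inverse fps_zero fps_opp fps_add.
Proof. by move=> f; apply: fpsP => n /=; rewrite addNr. Qed.

HB.instance Definition _ := GRing.isZmodule.Build (fps F)
  fps_addA fps_addC fps_add0 fps_addN.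

Definition fps_trunc (n : nat) f : {poly F} := \poly_(i < n) coefs f i.

Lemma fps_mul_trunc n i f g : (i < n)%N ->
  coefs (fps_mul f g) i = (fps_trunc n f * fps_trunc n g)`_i.
Proof.
move=> lt_in; rewrite coefM; apply: eq_bigr => j _; rewrite !coef_poly.
have lt_jn : (j < n)%N by apply: leq_trans lt_in; rewrite ltnS -ltnS.
by rewrite lt_jn (leq_ltn_trans (leq_subr _ _) lt_in).
Qed.

Lemma fps_mulC : commutative fps_mul.
Proof.
move=> f g; apply: fpsP => n.
by rewrite !(@fps_mul_trunc n.+1) // mulrC.
Qed.

Lemma fps_mulA : associative fps_mul.
Proof.
have trM n f g h : coefs (fps_mul f (fps_mul g h)) n =
    (fps_trunc n.+1 f * (fps_trunc n.+1 g * fps_trunc n.+1 h))`_n.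
  rewrite (@fps_mul_trunc n.+1) // !coefM; apply: eq_bigr => j _.
  have lt_n : (n - j < n.+1)%N by rewrite ltnS leq_subr.
  by congr (_ * _); rewrite {1}coef_poly lt_n (@fps_mul_trunc n.+1).
move=> f g h; apply: fpsP => n.
by rewrite [in RHS]fps_mulC !trM mulrA mulrC.
Qed.

Lemma fps_mul1 : left_id fps_one fps_mul.
Proof.
move=> f; apply: fpsP => n /=; rewrite big_ord_recl /= mul1r subn0 big1 ?addr0//.
by move=> i _; rewrite mul0r.
Qed.

Lemma fps_mulDl : left_distributive fps_mul fps_add.
Proof.
move=> f g h; apply: fpsP => n /=; rewrite -big_split /=.
by apply: eq_bigr => i _; rewrite mulrDl.
Qed.

Lemma fps_one_neq0 : fps_one != 0.
Proof.
by apply/eqP => /(congr1 (fun f => coefs f 0))/eqP; rewrite /= oner_eq0.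
Qed.

HB.instance Definition _ := GRing.Zmodule_isComNzRing.Build (fps F)
  fps_mulA fps_mulC fps_mul1 fps_mulDl fps_one_neq0.

Fixpoint fps_inv_seq f (n : nat) : seq F :=
  if n is n'.+1 then
    let s := fps_inv_seq f n' in
    rcons s (- (coefs f 0)^-1 * \sum_(i < n) coefs f i.+1 * s`_(n' - i))
  else [:: (coefs f 0)^-1].

Definition fps_unit : {pred fps F} := fun f => coefs f 0 != 0.
Definition fps_inv f : fps F :=
  if f \in fps_unit then FPS (fun n => (fps_inv_seq f n)`_n) else f.

Lemma size_fps_inv_seq f n : size (fps_inv_seq f n) = n.+1.
Proof. by elim: n => //= n IHn; rewrite size_rcons IHn. Qed.

Lemma nth_fps_inv_seq f n i : (i <= n)%N ->
  (fps_inv_seq f n)`_i = (fps_inv_seq f i)`_i.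
Proof.
elim: n => [|n IHn]; first by rewrite leqn0 => /eqP ->.
rewrite leq_eqVlt => /predU1P[-> //|lt_in].
by rewrite /= nth_rcons size_fps_inv_seq lt_in IHn.
Qed.

Lemma fps_mulVf : {in fps_unit, left_inverse 1 fps_inv *%R}.
Proof.
move=> f Uf; rewrite mulrC /fps_inv Uf; apply: fpsP => -[|n] /=.
  by rewrite big_ord1 /= mulfV.
rewrite big_ord_recl /= subn0 nth_rcons size_fps_inv_seq ltnn eqxx.
rewrite mulrA mulrN mulfV // mulN1r; apply/eqP; rewrite addrC subr_eq0.
apply/eqP/eq_bigr => i _; rewrite /bump /= add1n subSS.
by rewrite [in RHS]nth_fps_inv_seq // leq_subr.
Qed.

Lemma fps_unitPl f g : g * f = 1 -> f \in fps_unit.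
Proof.
move/(congr1 (fun h => coefs h 0)); rewrite /= big_ord1 subn0 => gf1.
by apply: contra_eq_neq gf1 => ->; rewrite mulr0 eq_sym oner_eq0.
Qed.

Lemma fps_inv_out : {in [predC fps_unit], fps_inv =1 id}.
Proof. by move=> f /negPf nUf; rewrite /fps_inv nUf. Qed.

HB.instance Definition _ := GRing.ComNzRing_hasMulInverse.Build (fps F)
  fps_mulVf fps_unitPl fps_inv_out.

Lemma fps_unitE f : (f \is a GRing.unit) = (coefs f 0 != 0).
Proof. by []. Qed.

Definition fps_t : fps F := FPS (fun n => (n == 1)%:R).

End FpsRing.

Definition fps_exp (R : numFieldType) (x : R) : fps R :=
  FPS (fun n => x ^+ n / n`!%:R).

(* t / (e^t - 1): the series e^t - 1 is not a unit, so the ring quotient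
   fps_t / (fps_exp 1 - 1) would be a junk value. We invert (e^t - 1) / t
   instead, whose coefficients are the 1 / (n + 1)!. *)
Definition fps_t_div_expm1 (R : numFieldType) : fps R :=
  (FPS (fun n => (n.+1)`!%:R^-1))^-1.

Lemma fps_t_div_expm1_unit (R : numFieldType) :
  fps_t_div_expm1 R \is a GRing.unit.
Proof. by rewrite unitrV fps_unitE /= invr1 oner_eq0. Qed.

Lemma fps_t_div_expm1P (R : numFieldType) :
  fps_t_div_expm1 R * (fps_exp 1 - 1) = fps_t R.
Proof.
have -> : fps_exp 1 - 1 = FPS (fun n => (n.+1)`!%:R^-1) * fps_t R.
  apply: fpsP => -[|n].
    by rewrite /= big_ord1 /= mulr0 expr0 divr1 subrr.
  rewrite /= expr1n mul1r subr0 big_ord_recr /= subnn mulr0 addr0.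
  rewrite big_ord_recr /= subSnn mulr1 big1 ?add0r // => i _.
  by rewrite subSn ?(ltnW (ltn_ord i)) // eqSS subn_eq0 leqNgt ltn_ord mulr0.
by rewrite mulrA mulVr ?mul1r // fps_unitE /= invr1 oner_eq0.
Qed.

(* (e^t - 1)^n = n! * \sum_(l >= n) S_2(l, n) t^l / l! *)
Definition stirling2 (R : numFieldType) (l n : nat) : R :=
  l`!%:R / n`!%:R * coefs ((fps_exp (1 : R) - 1) ^+ n) l.

(* (t / (e^t - 1))^alpha * e^(x t) = \sum_n B_n^(alpha)(x) t^n / n! *)
Definition bernoulli (R : numFieldType) (alpha : int) (n : nat) (x : R) : R :=
  n`!%:R * coefs (fps_t_div_expm1 R ^ alpha * fps_exp x) n.

Lemma stirling2_small (R : numFieldType) (l n : nat) :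
  (l < n)%N -> stirling2 R l n = 0.
Proof.
move=> lt_ln; suff e0 : coefs ((fps_exp (1 : R) - 1) ^+ n) l = 0.
  by rewrite /stirling2 e0 mulr0.
elim: n l lt_ln => // n IHn l lt_ln; rewrite exprS /= big_ord_recl /=.
rewrite expr0 divr1 subrr mul0r add0r big1 // => i _.
rewrite IHn ?mulr0 //= /bump /= add1n.
by case: l i lt_ln => [[]|l i] //= lt_ln; rewrite subSS (leq_ltn_trans (leq_subr _ _)).
Qed.

Lemma stirling2P (R : numFieldType) (n : nat) :
  (fps_exp (1 : R) - 1) ^+ n =
  n`!%:R * FPS (fun l => if (n <= l)%N then stirling2 R l n / l`!%:R else 0).
Proof.
have natM (k : nat) (f : fps R) l : coefs (k%:R * f) l = k%:R * coefs f l.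
  rewrite !mulr_natl; elim: k => [|k IHk]; first by rewrite !mulr0n.
  by rewrite !mulrS -IHk.
have fact_neq0 k : k`!%:R != 0 :> R by rewrite pnatr_eq0 -lt0n fact_gt0.
have S2E l : coefs ((fps_exp (1 : R) - 1) ^+ n) l =
    n`!%:R * (stirling2 R l n / l`!%:R).
  by rewrite /stirling2; field; rewrite !fact_neq0.
apply: fpsP => l; rewrite natM S2E /=; case: leqP => // lt_ln.
by rewrite stirling2_small // mul0r.
Qed.

Lemma bernoulliP (R : numFieldType) (alpha : int) (x : R) :
  fps_t_div_expm1 R ^ alpha * fps_exp x =
  FPS (fun n => bernoulli alpha n x / n`!%:R).
Proof.
apply: fpsP => n.
by rewrite [RHS]/= /bernoulli [RHS]mulrC mulKf // pnatr_eq0 -lt0n fact_gt0.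
Qed.

Definition falling (R : pzRingType) (x : R) (n : nat) : R :=
  \prod_(i < n) (x - i%:R).

Fixpoint unit_cube_integral (R : realType) (k : nat) :
    (k.-tuple R -> R) -> R :=
  if k is k'.+1 then fun f =>
    \int[lebesgue_measure]_(x in `[0, 1])
      unit_cube_integral (fun t : k'.-tuple R => f [tuple of x :: t])
  else fun f => f [tuple].

Definition cauchy_number (R : realType) (k n : nat) : R :=
  unit_cube_integral
    (fun x : k.-tuple R => falling (\sum_(i < k) tnth x i) n).

(* Main.v *)
Require Import Defs.
From HB Require Import structures.
From mathcomp Require Import all_boot all_order all_algebra.
From mathcomp Require Import all_classical all_reals all_analysis.
From mathcomp Require Import ring.
Import Order.TTheory GRing.Theory Num.Theory.
Import numFieldNormedType.Exports.

Local Open Scope ring_scope.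

(** Write h = (e^t - 1) / t, so that e^t - 1 = t h, and [t^m] f for the
coefficient of t^m in f. Both equalities follow from two facts about the
Cauchy numbers of order k.

The first is that h^k is the exponential moment generating function of
x_1 + ... + x_k on the unit cube. In operator form, with D the derivation of
polynomials, integrating p (y + x_1 + ... + x_k) over the cube gives
(h (D)^k p) (y), because P (y + 1) - P (y) = ((e^D - 1) P) (y) when P is an
antiderivative of p (unit_cube_integral_horner). This operator calculus reduces
the k-fold integral to one use of the fundamental theorem of calculus per
variable. Applied to the expansion X^m = sum_n S_2(m, n) (X)_n
(exprX_stirling2) it gives

  sum_n C_n^(k) S_2(m, n) = m! [t^m] h^k,

(sum_cauchy_stirling2), and the right-hand side is S_2(m + k, k) divided by a
binomial coefficient, since (e^t - 1)^k = t^k h^k.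

The second fact is the equality C_n^(k) = B_n^(n - k + 1)(1), term by term
(cauchy_number_bernoulli). The displayed identity says that C_n^(k) / n! are
the coefficients of h^k in powers of phi = e^t - 1. Lagrange inversion extracts
the n-th of them as the residue of h^k phi' / phi^(n + 1), that is, as
[t^n] (h^(k - n - 1) e^t), and this is B_n^(n - k + 1)(1) / n!. *)

(** * Euler derivation and Lagrange inversion *)

Section FormalPowerSeries.
Variable F : fieldType.
Implicit Types (f g h : fps F) (n d i : nat).

Lemma coefs_mul f g n :
  coefs (f * g) n = \sum_(i < n.+1) coefs f i * coefs g (n - i).
Proof. by []. Qed.

Lemma coefsD f g n : coefs (f + g) n = coefs f n + coefs g n.
Proof. by []. Qed.

Lemma coefsB f g n : coefs (f - g) n = coefs f n - coefs g n.
Proof. by []. Qed.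

Lemma coefsMn f d n : coefs (f *+ d) n = coefs f n *+ d.
Proof. by elim: d => //= d IHd; rewrite !mulrS coefsD IHd. Qed.

Lemma coefs_mulXn f d n :
  coefs (f * fps_t F ^+ d) n = if (n < d)%N then 0 else coefs f (n - d).
Proof.
elim: d n => [|d IHd] n; first by rewrite mulr1 subn0.
have XS g m : coefs (fps_t F * g) m = if m is m'.+1 then coefs g m' else 0.
  rewrite coefs_mul big_ord_recl /= mul0r add0r.
  case: m => [|m]; first by rewrite big_ord0.
  rewrite big_ord_recl /= mul1r subSS subn0 big1 ?addr0 // => i _.
  by rewrite /= mul0r.
by rewrite exprS mulrCA XS; case: n => [|n] //; rewrite IHd ltnS subSS.
Qed.

Lemma coefs_mulX f n : coefs (f * fps_t F) n.+1 = coefs f n.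
Proof. by rewrite -[fps_t F]expr1 coefs_mulXn /= subSS subn0. Qed.

(** The operator t d/dt is used in place of d/dt: it does not shift the
coefficients, so its Leibniz rule holds term by term, and t (t h)' = t (h + E h)
for this operator E lets phi' be written h + E h when phi = t h. *)
Definition fps_euler f : fps F := FPS (fun n => n%:R * coefs f n).

Lemma fps_eulerM f g : fps_euler (f * g) = fps_euler f * g + f * fps_euler g.
Proof.
apply: fpsP => n; rewrite coefsD /= mulr_sumr -big_split /=.
apply: eq_bigr => i _.
rewrite -{1}(subnKC (leq_ord i)) natrD; ring.
Qed.

Lemma fps_euler1 : fps_euler 1 = 0.
Proof. by apply: fpsP => -[|n] /=; rewrite ?mul0r ?mulr0. Qed.

Lemma fps_eulerX f n : fps_euler (f ^+ n.+1) = (f ^+ n * fps_euler f) *+ n.+1.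
Proof.
elim: n => [|n IHn]; first by rewrite expr1 mul1r.
rewrite exprS fps_eulerM IHn [in RHS]mulrS mulrnAr mulrA -exprS.
by rewrite [fps_euler f * _]mulrC.
Qed.

Lemma fps_eulerV f : f \is a GRing.unit ->
  fps_euler f^-1 = - (f^-1 ^+ 2 * fps_euler f).
Proof.
move=> Uf; apply: (mulIr Uf).
have /eqP := fps_eulerM f^-1 f.
rewrite mulVr // fps_euler1 eq_sym addr_eq0 => /eqP ->.
by rewrite mulNr expr2 -!mulrA [fps_euler f * f]mulrC mulKr.
Qed.

(** With phi = t h, the coefficient on the left is the residue of
phi' / phi^(d + 1). For d > 0 this vanishes because the form is the exact
differential of - phi^(-d) / d; concretely, d times the series is
d h^(-d) - E (h^(-d)), whose coefficient at t^d is d - d = 0 times that of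
h^(-d). *)
Lemma fps_residue h d : [pchar F] =i pred0 -> h \is a GRing.unit ->
  coefs (h^-1 ^+ d.+1 * (h + fps_euler h)) d = (d == 0)%:R.
Proof.
move=> pchar0 Uh.
have -> : h^-1 ^+ d.+1 * (h + fps_euler h)
    = h^-1 ^+ d + h^-1 ^+ d.+1 * fps_euler h.
  by rewrite mulrDr {1}exprSr -mulrA mulVr ?mulr1.
case: d => [|d].
  by rewrite expr0 coefsD coefs_mul big_ord1 /= !(mul0r,mulr0) addr0.
have nz : d.+1%:R != 0 :> F by rewrite (proj1 (pcharf0P F) pchar0).
apply: (mulfI nz); rewrite mulr0 coefsD mulrDr.
have : coefs (fps_euler (h^-1 ^+ d.+1)) d.+1
    = - (d.+1%:R * coefs (h^-1 ^+ d.+2 * fps_euler h) d.+1).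
  rewrite fps_eulerX fps_eulerV // mulrN mulrA -exprD addn2.
  by rewrite coefsMn mulr_natl mulNrn.
by rewrite /= => ->; rewrite addNr.
Qed.

(** Multiplying the expansion of f in powers of phi = t h by
phi' / phi^(n + 1) turns its j-th term into c_j phi' / phi^(n - j + 1), whose
residue is c_j if j = n and 0 otherwise. The expansion is needed only up to
order n, which keeps its sum finite. *)
Lemma lagrange_inversion h f (c : nat -> F) n :
    [pchar F] =i pred0 -> h \is a GRing.unit ->
    (forall i, (i <= n)%N ->
       coefs f i = \sum_(j < n.+1) c j * coefs ((h * fps_t F) ^+ j) i) ->
  coefs (f * (h^-1 ^+ n.+1 * (h + fps_euler h))) n = c n.
Proof.
move=> pchar0 Uh fE; set g := h^-1 ^+ n.+1 * _.
have -> : coefs (f * g) n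
    = \sum_(j < n.+1) c j * coefs ((h * fps_t F) ^+ j * g) n.
  rewrite coefs_mul.
  under eq_bigr => i _ do rewrite fE ?leq_ord // mulr_suml.
  rewrite exchange_big; apply: eq_bigr => j _.
  by rewrite coefs_mul mulr_sumr; apply: eq_bigr => i _; rewrite mulrA.
have termE (j : 'I_n.+1) :
    coefs ((h * fps_t F) ^+ j * g) n = ((n - j)%N == 0)%:R.
  rewrite -(@fps_residue h) // exprMn mulrAC coefs_mulXn ifF ?ltnNge ?leq_ord //.
  have -> : g = h^-1 ^+ j * h^-1 ^+ (n - j).+1 * (h + fps_euler h).
    by rewrite -exprD addnS subnKC ?leq_ord.
  by rewrite !mulrA -exprMn mulrV // expr1n mul1r.
under eq_bigr => j _ do rewrite termE subn_eq0.
rewrite big_ord_recr /= leqnn mulr1 big1 ?add0r // => j _.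
by rewrite leqNgt ltn_ord mulr0.
Qed.

End FormalPowerSeries.

(** * The exponential series and Stirling numbers *)

Section Exponential.
Variable R : numFieldType.
Implicit Types (f g : fps R) (p q : {poly R}) (x y : R).

Definition fps_expm1_div_t : fps R := FPS (fun n => (n.+1)`!%:R^-1).
Local Notation h := fps_expm1_div_t.

Lemma natfact_neq0 n : n`!%:R != 0 :> R.
Proof. by rewrite pnatr_eq0 -lt0n fact_gt0. Qed.

Lemma fps_expm1_div_t_unit : h \is a GRing.unit.
Proof. by rewrite fps_unitE /= invr1 oner_eq0. Qed.

Lemma fps_expm1E : fps_exp 1 - 1 = h * fps_t R.
Proof.
by rewrite -(fps_t_div_expm1P R) /fps_t_div_expm1 mulVKr ?fps_expm1_div_t_unit.
Qed.

Lemma fps_exp0 : fps_exp 0 = 1 :> fps R.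
Proof.
apply: fpsP => -[|n] /=; first by rewrite expr0 divr1.
by rewrite expr0n /= mul0r.
Qed.

Lemma fps_expD x y : fps_exp (x + y) = fps_exp x * fps_exp y.
Proof.
apply: fpsP => n; rewrite coefs_mul /= addrC exprDn mulr_suml.
apply: eq_bigr => i _.
rewrite -mulr_natl -(bin_fact (leq_ord i)) !natrM; field.
rewrite !natfact_neq0 /= pnatr_eq0 -lt0n bin_gt0; exact: leq_ord.
Qed.

Lemma fps_exp1_euler : fps_exp 1 = h + fps_euler _ h.
Proof.
apply: fpsP => n; rewrite coefsD /= expr1n factS natrM; field.
by rewrite natfact_neq0 nat1r pnatr_eq0.
Qed.

Lemma euler_expm1 : fps_euler _ (fps_exp 1 - 1) = fps_exp 1 * fps_t R :> fps R.
Proof.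
apply: fpsP => -[|n].
  by rewrite -[fps_t R]expr1 coefs_mulXn /= mul0r.
rewrite coefs_mulX /= subr0 !expr1n factS natrM; field.
by rewrite natfact_neq0 nat1r pnatr_eq0.
Qed.

(** Euler's derivation applied to u^(n + 1), u = e^t - 1, gives
(n + 1) u^n e^t t, and e^t = u + 1. *)
Lemma coefs_expm1XS n m :
  m.+1%:R * coefs ((fps_exp (1 : R) - 1) ^+ n.+1) m.+1
  = n.+1%:R * (coefs ((fps_exp 1 - 1) ^+ n.+1) m
             + coefs ((fps_exp 1 - 1) ^+ n) m).
Proof.
set u := fps_exp 1 - 1.
have -> : m.+1%:R * coefs (u ^+ n.+1) m.+1
    = coefs (fps_euler R (u ^+ n.+1)) m.+1 by [].
rewrite fps_eulerX euler_expm1 coefsMn mulrA coefs_mulX mulr_natl.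
congr (_ *+ _).
by rewrite -coefsD exprSr -[in LHS](subrK 1 (fps_exp 1)) -/u mulrDr mulr1.
Qed.

Lemma stirling2SS m n :
  stirling2 R m.+1 n.+1 = n.+1%:R * stirling2 R m n.+1 + stirling2 R m n.
Proof.
rewrite /stirling2 factS natrM [m.+1%:R * _]mulrC -!mulrA.
rewrite [m.+1%:R * _]mulrCA coefs_expm1XS factS natrM; field.
by rewrite natfact_neq0 nat1r pnatr_eq0.
Qed.

Lemma stirling2S0 m : stirling2 R m.+1 0 = 0.
Proof. by rewrite /stirling2 expr0 /= mulr0. Qed.

Definition falling_poly n : {poly R} := \prod_(i < n) ('X - i%:R%:P).

Lemma horner_falling_poly n x : (falling_poly n).[x] = falling x n.
Proof.
rewrite /falling horner_prod; apply: eq_bigr => i _.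
by rewrite !hornerE.
Qed.

Lemma mulX_falling_poly n :
  'X * falling_poly n = falling_poly n.+1 + n%:R *: falling_poly n.
Proof.
rewrite {2}/falling_poly big_ord_recr /= -/(falling_poly n) -mul_polyC; ring.
Qed.

(** Multiplication by X sends (X)_n to (X)_(n + 1) + n (X)_n, which matches the
recurrence S_2(m + 1, n + 1) = (n + 1) S_2(m, n + 1) + S_2(m, n). *)
Lemma exprX_stirling2 m :
  'X^m = \sum_(n < m.+1) stirling2 R m n *: falling_poly n.
Proof.
elim: m => [|m IHm].
  rewrite big_ord1 /stirling2 /falling_poly big_ord0 !expr0 /=.
  by rewrite divr1 mul1r scale1r.
rewrite exprS IHm mulr_sumr [RHS]big_ord_recl /= stirling2S0 scale0r add0r.
under eq_bigr => n _ do
  rewrite -scalerAr mulX_falling_poly scalerDr scalerA mulrC.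
under [RHS]eq_bigr => n _ do
  rewrite /bump /= add1n stirling2SS scalerDl.
rewrite !big_split /= addrC; congr (_ + _).
  (* Reindexing the part with factor n: the terms n = 0 and n = m + 1 vanish. *)
transitivity
  (\sum_(n < m.+2) (n%:R * stirling2 R m n) *: falling_poly n).
  by rewrite [RHS]big_ord_recr /= stirling2_small // mulr0 scale0r addr0.
by rewrite big_ord_recl /= mul0r scale0r add0r.
Qed.

Lemma stirling2_addr k m :
  stirling2 R (m + k) k = 'C(m + k, m)%:R * (m`!%:R * coefs (h ^+ k) m).
Proof.
rewrite /stirling2 fps_expm1E exprMn coefs_mulXn ltnNge leq_addl /= addnK.
have := bin_fact (leq_addr k m); rewrite addKn => <-; rewrite !natrM.
by field; rewrite natfact_neq0.
Qed.

(** * Umbral operators *)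

(** The polynomial y |-> [t^i] (f e^(t y)), which is f (D) applied to
X^i / i!. *)
Definition appell f i : {poly R} :=
  \sum_(j < i.+1) (coefs f j / (i - j)`!%:R) *: 'X^(i - j).

Lemma horner_appell f i y : (appell f i).[y] = coefs (f * fps_exp y) i.
Proof.
rewrite /appell coefs_mul horner_sum; apply: eq_bigr => j _.
by rewrite hornerE hornerXn /= mulrAC mulrA.
Qed.

Lemma deriv_appell f i : (appell f i.+1)^`() = appell f i.
Proof.
rewrite /appell big_ord_recr /= subnn derivD derivZ derivC scaler0 addr0.
rewrite raddf_sum /=; apply: eq_bigr => j _.
rewrite derivZ derivXn subSn ?leq_ord //= factS natrM -['X^_ *+ _]scaler_nat.
rewrite scalerA; congr (_ *: _).
by field; rewrite natfact_neq0 nat1r pnatr_eq0.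
Qed.

(** The differential operator f (D) of infinite order, written on the monomial
basis so that linearity in p is visible and f is only ever used through
products of series. *)
Definition umbral f p : {poly R} :=
  \sum_(i < size p) (p`_i * i`!%:R) *: appell f i.

Lemma umbral_widen f p n : (size p <= n)%N ->
  umbral f p = \sum_(i < n) (p`_i * i`!%:R) *: appell f i.
Proof.
move=> le_pn; rewrite /umbral.
rewrite (big_ord_widen n (fun i => (p`_i * i`!%:R) *: appell f i)) //.
rewrite big_mkcond; apply: eq_bigr => i _; case: ltnP => // le_pi.
by rewrite nth_default // mul0r scale0r.
Qed.

Lemma umbral_is_linear f : linear (umbral f).
Proof.
move=> a p q; set n := maxn (size (a *: p + q)) (maxn (size p) (size q)).
rewrite !(@umbral_widen f _ n) ?leq_max ?leqnn ?orbT //.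
rewrite scaler_sumr -big_split /=; apply: eq_bigr => i _.
by rewrite coefD coefZ mulrDl scalerDl scalerA mulrA.
Qed.

HB.instance Definition _ f :=
  GRing.isLinear.Build R {poly R} {poly R} _ (umbral f) (umbral_is_linear f).

Lemma umbralXn f n y :
  (umbral f 'X^n).[y] = n`!%:R * coefs (f * fps_exp y) n.
Proof.
rewrite /umbral size_polyXn big_ord_recr /= big1 ?add0r => [|i _].
  by rewrite coefXn eqxx mul1r hornerE horner_appell.
by rewrite coefXn (ltn_eqF (ltn_ord i)) mul0r scale0r.
Qed.

Lemma umbral1 p : umbral 1 p = p.
Proof.
rewrite -[p in RHS]coefK poly_def; apply: eq_bigr => i _.
rewrite /appell big_ord_recl /= subn0 big1 ?addr0 => [|j _].
  rewrite scalerA; congr (_ *: _).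
  by field; rewrite natfact_neq0.
by rewrite mul0r scale0r.
Qed.

(** An antiderivative of f (D) p, obtained by raising the degree of every Appell
polynomial. *)
Definition umbral_primitive f p : {poly R} :=
  \sum_(i < size p) (p`_i * i`!%:R) *: appell f i.+1.

Lemma deriv_umbral_primitive f p : (umbral_primitive f p)^`() = umbral f p.
Proof.
rewrite raddf_sum /=; apply: eq_bigr => i _.
by rewrite derivZ deriv_appell.
Qed.

(** A unit shift of y multiplies the generating series f e^(t y) by e^t, and
e^t - 1 = t h; the factor t undoes the shift of index in the antiderivative. *)
Lemma umbral_primitiveB f p y :
  (umbral_primitive f p).[y + 1] - (umbral_primitive f p).[y]
  = (umbral (h * f) p).[y].
Proof.
rewrite !horner_sum -sumrB; apply: eq_bigr => i _.
rewrite !hornerZ !horner_appell -mulrBr -coefsB fps_expD; congr (_ * _).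
have -> : f * (fps_exp y * fps_exp 1) - f * fps_exp y
    = h * f * fps_exp y * fps_t R.
  by rewrite -[f * fps_exp y in LHS]mulr1 !mulrA -mulrBr fps_expm1E; ring.
by rewrite coefs_mulX.
Qed.

End Exponential.

(** * Integration over the cube and Cauchy numbers *)

Section CauchyNumbers.
Variable R : realType.
Implicit Types (p q : {poly R}) (x y : R).
Local Notation h := (fps_expm1_div_t R).

Lemma Rintegral_deriv_shift p y :
  \int[lebesgue_measure]_(x in `[0, 1]%classic) (p^`()).[y + x]
  = p.[y + 1] - p.[y].
Proof.
pose q := p \Po ('X + y%:P).
have qE x : p.[y + x] = q.[x] by rewrite horner_comp !hornerE addrC.
have dqE x : (p^`()).[y + x] = (q^`()).[x].
  by rewrite deriv_comp derivD derivX derivC addr0 mulr1 horner_comp !hornerE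
    addrC.
under eq_Rintegral do rewrite dqE.
rewrite -{2}[y]addr0 !qE /Rintegral.
rewrite (@continuous_FTC2 _ _ (horner q)) //=.
- by apply: continuous_subspaceT; exact: continuous_horner.
- split => [x _||].
  + exact: derivable_horner.
  + by apply: cvg_at_right_filter; exact: continuous_horner.
  + by apply: cvg_at_left_filter; exact: continuous_horner.
- by move=> x _; rewrite derivE.
Qed.

(** Each integration over [0, 1] applies one more factor h (D). The free shift y
carries the sum of the outer variables through the induction. *)
Lemma unit_cube_integral_horner p k y :
  unit_cube_integral (fun t : k.-tuple R => p.[y + \sum_(i < k) tnth t i])
  = (umbral R (h ^+ k) p).[y].
Proof.
elim: k y => [|k IHk] y; first by rewrite /= big_ord0 addr0 expr0 umbral1.
rewrite exprS -umbral_primitiveB -Rintegral_deriv_shift /=.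
apply: eq_Rintegral => x _; rewrite deriv_umbral_primitive -IHk.
congr unit_cube_integral; apply/funext => t.
rewrite big_ord_recl tnth0 addrA; congr (p.[_ + _]).
by apply: eq_bigr => i _; rewrite tnthS.
Qed.

Lemma cauchy_numberE k n :
  cauchy_number R k n = (umbral R (h ^+ k) (falling_poly R n)).[0].
Proof.
rewrite -unit_cube_integral_horner; congr unit_cube_integral.
by apply/funext => t; rewrite add0r horner_falling_poly.
Qed.

Lemma sum_cauchy_stirling2 k m :
  \sum_(n < m.+1) cauchy_number R k n * stirling2 R m n
  = m`!%:R * coefs (h ^+ k) m.
Proof.
rewrite -[h ^+ k]mulr1 -(fps_exp0 R) -umbralXn exprX_stirling2.
rewrite linear_sum horner_sum; apply: eq_bigr => n _.
by rewrite linearZ hornerZ /= -cauchy_numberE mulrC.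
Qed.

(** For i <= n, [t^i] h^k = sum_j (C_j^(k) / j!) [t^i] (e^t - 1)^j restates
sum_cauchy_stirling2, so Lagrange inversion computes C_n^(k) / n!. *)
Lemma cauchy_number_bernoulli k n :
  cauchy_number R k n = bernoulli (n%:Z - k%:Z + 1) n (1 : R).
Proof.
have Uh := fps_expm1_div_t_unit R.
have gE : fps_t_div_expm1 R ^ (n%:Z - k%:Z + 1) = h ^+ k * h^-1 ^+ n.+1.
  rewrite -[fps_t_div_expm1 R]/(h^-1) addrAC -PoszD addn1.
  by rewrite exprzDr ?unitrV // -exprz_inv invrK mulrC.
rewrite /bernoulli gE -mulrA fps_exp1_euler.
rewrite (@lagrange_inversion _ _ _ (fun j => cauchy_number R k j / j`!%:R)) //.
- by field; rewrite natfact_neq0.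
- exact: pchar_num.
move=> i le_in; apply: (mulfI (natfact_neq0 R i)).
rewrite -sum_cauchy_stirling2 mulr_sumr.
(* The sum stops at i, the expansion at n >= i: S_2(i, j) = 0 for j > i. *)
rewrite (big_ord_widen n.+1
  (fun j => cauchy_number R k j * stirling2 R i j)) ?ltnS //.
rewrite big_mkcond; apply: eq_bigr => j _.
rewrite -fps_expm1E; have -> : i`!%:R * (cauchy_number R k j / j`!%:R *
    coefs ((fps_exp 1 - 1) ^+ j) i) = cauchy_number R k j * stirling2 R i j.
  by rewrite /stirling2; ring.
by case: ltnP => // lt_ij; rewrite stirling2_small ?mulr0.
Qed.

End CauchyNumbers.

Theorem theorem2p3 (R : realType) (m k : nat) (hk : (1 <= k)%N) :
  stirling2 R (m + k) k
    = 'C(m + k, m)%:R * \sum_(0 <= n < m.+1)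
        cauchy_number R k n * stirling2 R m n
  /\
  'C(m + k, m)%:R * \sum_(0 <= n < m.+1)
        cauchy_number R k n * stirling2 R m n
    = 'C(m + k, m)%:R * \sum_(0 <= n < m.+1)
        bernoulli (n%:Z - k%:Z + 1) n (1 : R) * stirling2 R m n.
Proof.
split.
  by rewrite big_mkord sum_cauchy_stirling2 stirling2_addr.
by congr (_ * _); apply: eq_bigr => n _; rewrite cauchy_number_bernoulli.
Qed.
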